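(* For every meager subset $C\subset[0,1]$ there is a map $\phi\in\mathcal{H}$, $\phi\colon[0,1]\to[0,1]$, such that $\phi(C)$ is FAP.
   Context: $\mathcal{H}$ denotes the set of homeomorphisms $\phi\colon[0,1]\to[0,1]$ (of the unit interval onto itself). A $3$-term arithmetic progression (AP) is a sequence $x,\,x+d,\,x+2d$ of real numbers with step $d>0$. A set $S\subset\mathbb{R}$ is FAP if it contains no $3$-term APs. A set $S\subset\mathbb{R}$ is nowhere dense if its closure in $\mathbb{R}$ has empty interior, and meager if it is a countable union of nowhere dense sets. *)

(* Defs.v *)
From HB Require Import structures.
From mathcomp Require Import all_boot all_order all_algebra.
From mathcomp Require Import all_classical all_reals all_analysis.

Set Implicit Arguments.
Unset Strict Implicit.
Unset Printing Implicit Defensive.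

Import Order.TTheory GRing.Theory Num.Theory.
Import numFieldNormedType.Exports.

Local Open Scope classical_set_scope.
Local Open Scope ring_scope.

Definition nowhere_dense (T : topologicalType) (A : set T) : Prop :=
  interior (closure A) = set0.

(* Finite unions are covered, since [F n] may be empty. *)
Definition meager (T : topologicalType) (A : set T) : Prop :=
  exists2 F : (set T)^nat,
    forall n, nowhere_dense (F n) & A = \bigcup_n F n.

(* Homeomorphisms from [A] onto [B] with their subspace topologies, encoded by
   total functions whose values outside [A] (resp. [B]) are irrelevant. *)
Definition homeomorphism_on (T U : topologicalType) (A : set T) (B : set U)
    (f : T -> U) : Prop :=
  set_fun A B f /\ {within A, continuous f} /\
  exists g : U -> T,
    [/\ set_fun B A g, {within B, continuous g},
        (forall x, A x -> g (f x) = x) & (forall y, B y -> f (g y) = y)].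

Definition unit_homeo (R : realType) : set (R -> R) :=
  [set phi | homeomorphism_on (`[0, 1] : set R) (`[0, 1] : set R) phi].

Definition FAP (R : realType) (S : set R) : Prop :=
  ~ exists x d : R, [/\ 0 < d, S x, S (x + d) & S (x + 2 * d)].

(* Main.v *)
Require Import Defs.
From HB Require Import structures.
From mathcomp Require Import all_boot all_order all_algebra.
From mathcomp Require Import all_classical all_reals all_analysis.
From mathcomp Require Import ring lra zify.
Import Order.TTheory GRing.Theory Num.Theory.
Import numFieldNormedType.Exports.
Local Open Scope classical_set_scope.
Local Open Scope ring_scope.

(** Write [C] as the union of nowhere dense sets [F n].  The homeomorphism is the
    normalization of [psi = \sum_j w j * g j], where [w j = 2 ^- (j ^ 2)] and
    each [g j] is a Cantor function rising from 0 to 1 inside an interval [I j];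
    every subinterval of [0, 1] contains infinitely many of the [I j], which makes
    [psi] strictly increasing.

    Each [g j] rises only on a Cantor set disjoint from [C].  This set is the
    limit of a binary tree of intervals in which the children of a node of depth
    [m] avoid [F m]; so on [F m] the function [g j] is already determined at depth [m + 1]
    and takes only multiples of [2 ^- m.+1] as values, with the same denominator
    for all [j] ([adapted_step_exists]).

    Suppose now that [psi a + psi c = 2 * psi b] with [a < b < c] in [C], and put
    [t j = g j a + g j c - 2 * g j b].  Then [\sum_j w j * t j = 0], where the
    [t j] are multiples of a single [2 ^- N].  The partial sum up to [k] is a
    multiple of [2 ^- (k ^ 2 + N)], and its absolute value is that of the
    remaining tail, which is of order [2 ^- (k.+1 ^ 2)].  As [2 * k] eventually
    exceeds [N] by more than the constants involved, the partial sums vanish for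
    large [k], and so do the coefficients [t j]
    ([lacunary_coefficients_vanish]).  But some [I j] with [j] arbitrarily large
    lies between [a] and [b], and for it [t j = 0 + 1 - 2 = -1]. *)

Set Implicit Arguments.
Unset Strict Implicit.

(** * Uniform limits and homeomorphisms of the unit interval *)

(** The telescoping form of the bound gives the pointwise limit by monotone
    convergence, since [f n x - e n] is nondecreasing in [n], and it gives the
    error estimate [e n] with no loss of constant. *)
Lemma telescoping_uniform_limit (R : realType) (f : nat -> R -> R) (e : nat -> R) :
    (forall n, continuous (f n)) -> e @ \oo --> 0 ->
    (forall n x, `|f n.+1 x - f n x| <= e n - e n.+1) ->
  exists g : R -> R,
    [/\ continuous g, forall x, f ^~ x @ \oo --> g x
      & forall n x, `|g x - f n x| <= e n].
Proof.
move=> fc e0 fe.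
have bound n k x : `|f (k + n)%N x - f n x| <= e n - e (k + n)%N.
  elim: k => [|k IH]; first by rewrite !subrr normr0.
  rewrite addSn; have := fe (k + n)%N x; move: IH.
  by rewrite !ler_norml => /andP[? ?] /andP[? ?]; apply/andP; split; lra.
have incr x : nondecreasing_seq (fun n => f n x - e n).
  apply/nondecreasing_seqP => n; have := fe n x.
  by rewrite ler_norml => /andP[? ?]; lra.
have enD n k : e (k + n)%N <= e n.
  by rewrite -subr_ge0; apply: le_trans (bound n k 0).
have e_ge0 n : 0 <= e n.
  apply: (cvgr_to_le e0).
  exists n => // k /= nk; rewrite -(subnK nk); exact: enD.
have cv x : (fun n => f n x - e n) @ \oo --> limn (fun n => f n x - e n).
  apply: nondecreasing_is_cvgn => //; exists (f 0%N x + e 0%N) => _ [n _ <-].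
  have := bound 0%N n x; rewrite addn0 ler_norml => /andP[? ?].
  by have := e_ge0 n; lra.
pose g x := limn (fun n => f n x - e n).
have fg x : f ^~ x @ \oo --> g x.
  have -> : f ^~ x = (fun n => f n x - e n + e n) by apply/funext=> n; rewrite subrK.
  by rewrite -[X in _ --> X]addr0; apply: cvgD.
have fgn n x : `|g x - f n x| <= e n.
  rewrite distrC.
  have c : (fun k => `|f n x - f k x|) @ \oo --> `|f n x - g x|.
    by apply: cvg_norm; apply: cvgB; [exact: cvg_cst|exact: fg].
  apply: (cvgr_to_le c).
  exists n => // k /= nk; rewrite -(subnK nk) distrC.
  by apply: le_trans (bound _ _ _) _; have := e_ge0 (k - n + n)%N; lra.
exists g; split => // x.
apply/cvgrPdist_le => eps eps0.
have [n en] : exists n, e n <= eps / 3.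
  have /cvgrPdist_le/(_ (eps / 3)) := e0; case; first lra.
  move=> n _ /(_ n (leqnn n)) /=; rewrite sub0r normrN => en; exists n.
  exact: le_trans (ler_norm _) en.
have /cvgrPdist_le/(_ (eps / 3)) := fc n x; case/(_ _); first lra.
move=> d d0 H; exists d => // y /H /= fy.
have := fgn n x; have := fgn n y; move: fy.
rewrite !ler_norml => /andP[? ?] /andP[? ?] /andP[? ?]; apply/andP; split; lra.
Qed.

Lemma increasing_unit_homeo (R : realType) (phi : R -> R) :
    continuous phi -> phi 0 = 0 -> phi 1 = 1 ->
    (forall x y, 0 <= x -> x < y -> y <= 1 -> phi x < phi y) ->
  unit_homeo phi.
Proof.
move=> cphi phi0 phi1 incr.
have le01 : (0 : R) <= 1 by exact: ler01.
have wphi : {within `[0, 1], continuous phi} by exact: continuous_subspaceT.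
have leE x y : 0 <= x -> x <= y -> y <= 1 -> phi x <= phi y.
  by move=> x0; rewrite le_eqVlt => /orP[/eqP->//|xy] y1; exact/ltW/incr.
have inj : {in `[0, 1] &, injective phi}.
  move=> x y; rewrite !in_itv /= => /andP[x0 x1] /andP[y0 y1] E.
  case: (ltrgtP x y) => // xy.
  - by have := incr _ _ x0 xy y1; rewrite E ltxx.
  - by have := incr _ _ y0 xy x1; rewrite E ltxx.
have [h hK] : exists h, {in `[0, 1], cancel phi h}.
  have : forall y, exists x,
      (exists2 z, z \in `[0, 1]%R & phi z = y) -> x \in `[0, 1]%R /\ phi x = y.
    move=> y.
    have [[z z01 zy]|?] := pselect (exists2 z, z \in `[0, 1]%R & phi z = y).
      by exists z.
    by exists 0.
  move=> /(@choice R R)[h hP]; exists h => x x01.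
  have [] := hP (phi x); first by exists x.
  by move=> h01 /inj; apply.
have hc := segment_can_le_continuous le01 wphi hK.
have phiK := segment_continuous_le_can_sym le01 wphi hK.
rewrite phi0 phi1 in hc phiK.
have fun_phi : set_fun `[0, 1] `[0, 1] phi.
  move=> x /=; rewrite !in_itv /= => /andP[x0 x1]; apply/andP; split.
    by rewrite -phi0 leE.
  by rewrite -phi1 leE.
split => //; split => //; exists h; split => //.
move=> y y01.
have [x x01 xy] : exists2 x, x \in `[(0 : R), 1] & phi x = y.
  by apply: (IVT le01 wphi); rewrite phi0 phi1 minElt maxElt ltr01.
by rewrite -xy hK.
Qed.

(** * Gaps of nowhere dense sets *)

Definition avoiding_gap (R : realType) (F : set R) (I J : R * R) : Prop :=
  [/\ I.1 <= J.1, J.1 < J.2, J.2 <= I.2 & forall x, J.1 <= x <= J.2 -> ~ F x].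

Lemma nowhere_dense_gap (R : realType) (F : set R) (I : R * R) :
  nowhere_dense F -> I.1 < I.2 -> exists J, avoiding_gap F I J.
Proof.
case: I => l r nF /= lr.
have [x [lxr nx]] : exists x, l < x < r /\ ~ closure F x.
  apply: contrapT => /forallNP H.
  suff : (interior (closure F)) ((l + r) / 2) by rewrite nF.
  exists ((r - l) / 2) => /=; first lra.
  move=> x; rewrite /ball /= ltr_norml => /andP[? ?].
  by apply: contrapT => ncl; apply: (H x); split => //; apply/andP; split; lra.
have : nbhs x (~` closure F).
  by apply: open_nbhs_nbhs; split => //; exact/closed_openC/closed_closure.
case=> d /= d0 dF.
have /andP[lx xr] := lxr.
exists (Num.max l (x - d / 2), Num.min r (x + d / 2)); split => /=.
- by rewrite le_max lexx.
- rewrite lt_min !gt_max; apply/andP; split; apply/andP; split; lra.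
- by rewrite ge_min lexx.
move=> y; rewrite ge_max le_min => /andP[/andP[_ yl] /andP[_ yr]] Fy.
apply: (dF y); last exact: subset_closure.
by rewrite /ball /= ltr_norml; apply/andP; split; lra.
Qed.

(** * Cantor functions with prescribed plateaus *)

Definition ramp (R : realType) (I : R * R) (x : R) : R :=
  Num.max 0 (Num.min 1 ((x - I.1) / (I.2 - I.1))).

Definition half (R : realType) (b : bool) (I : R * R) : R * R :=
  let c := (I.1 + I.2) / 2 in if b then (c, I.2) else (I.1, c).

(** The [n]-th approximation of the Cantor function on [I].  The recursion goes
    from the root of the tree: a Cantor function is the average of the Cantor
    functions of its two children.  The argument [m] is the depth of [I], which
    tells the gap function which set the children have to avoid. *)
Fixpoint staircase (R : realType) (gap : nat -> R * R -> R * R) (n m : nat)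
    (I : R * R) (x : R) : R :=
  if n is n'.+1 then
    (staircase gap n' m.+1 (gap m (half false I)) x +
     staircase gap n' m.+1 (gap m (half true I)) x) / 2
  else ramp I x.

Lemma staircaseS (R : realType) (gap : nat -> R * R -> R * R) n m I x :
  staircase gap n.+1 m I x =
    (staircase gap n m.+1 (gap m (half false I)) x +
     staircase gap n m.+1 (gap m (half true I)) x) / 2.
Proof. by []. Qed.

Lemma avoiding_gap_half (R : realType) (F : set R) b (I J : R * R) :
  I.1 < I.2 -> avoiding_gap F (half b I) J -> avoiding_gap F I J.
Proof.
move=> I12 [l1 J12 r2 JF]; split => //.
  by apply: le_trans l1; rewrite /half; case: (b) => /=; lra.
by apply: le_trans r2 _; rewrite /half; case: (b) => /=; lra.
Qed.

Lemma half_lt (R : realType) b (I : R * R) :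
  I.1 < I.2 -> (half b I).1 < (half b I).2.
Proof. by rewrite /half; case: b => /=; lra. Qed.

Section Staircase.
Context (R : realType) (F : nat -> set R) (gap : nat -> R * R -> R * R).
Context (gapP : forall m I, I.1 < I.2 -> avoiding_gap (F m) I (gap m I)).

Lemma gap_halfP m b I : I.1 < I.2 -> avoiding_gap (F m) I (gap m (half b I)).
Proof. by move=> I12; apply: (avoiding_gap_half I12); apply/gapP/half_lt. Qed.

Lemma staircase_continuous n m I : continuous (staircase gap n m I).
Proof.
elim: n m I => [|n IH] m I x /=.
  apply: (@continuous_max R R (fun=> 0) (fun y => Num.min 1 ((y - I.1) / (I.2 - I.1)))).
    exact: cvg_cst.
  apply: (@continuous_min R R (fun=> 1) (fun y => (y - I.1) / (I.2 - I.1))).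
    exact: cvg_cst.
  by apply: cvgMl; apply: cvgB; [exact: cvg_id|exact: cvg_cst].
by apply: cvgMl; apply: cvgD; exact: IH.
Qed.

Lemma staircase_le n m I x y : I.1 < I.2 -> x <= y ->
  staircase gap n m I x <= staircase gap n m I y.
Proof.
move=> + xy; elim: n m I => [|n IH] m I I12 /=.
  have h : (x - I.1) / (I.2 - I.1) <= (y - I.1) / (I.2 - I.1).
    by rewrite ler_pM2r ?invr_gt0; lra.
  by rewrite /ramp ge_max !le_max lexx /= le_min !ge_min lexx h orbT /= orbT.
have [_ c0 _ _] := gap_halfP m false I12.
have [_ c1 _ _] := gap_halfP m true I12.
by rewrite ler_pM2r ?invr_gt0 // lerD // IH.
Qed.

Lemma staircase_left n m I x : I.1 < I.2 -> x <= I.1 -> staircase gap n m I x = 0.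
Proof.
elim: n m I => [|n IH] m I I12 xI /=.
  rewrite /ramp; apply: max_idPl; rewrite ge_min; apply/orP; right.
  by rewrite pmulr_lle0 ?invr_gt0; lra.
have [l0 c0 _ _] := gap_halfP m false I12.
have [l1 c1 _ _] := gap_halfP m true I12.
by rewrite !IH ?addr0 ?mul0r // (le_trans xI).
Qed.

Lemma staircase_right n m I x : I.1 < I.2 -> I.2 <= x -> staircase gap n m I x = 1.
Proof.
elim: n m I => [|n IH] m I I12 xI /=.
  rewrite /ramp (_ : Num.min _ _ = 1) ?max_r ?ler01 //.
  by apply: min_idPl; rewrite ler_pdivlMr; lra.
have [_ c0 r0 _] := gap_halfP m false I12.
have [_ c1 r1 _] := gap_halfP m true I12.
by rewrite !IH ?(le_trans _ xI) //; field.
Qed.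

Lemma staircase_ge0 n m I x : I.1 < I.2 -> 0 <= staircase gap n m I x.
Proof.
move=> I12; have [xI|/ltW Ix] := leP x I.1; first by rewrite staircase_left.
by rewrite -(@staircase_left n m I I.1) // staircase_le.
Qed.

Lemma staircase_le1 n m I x : I.1 < I.2 -> staircase gap n m I x <= 1.
Proof.
move=> I12; have [xI|/ltW Ix] := leP I.2 x; first by rewrite staircase_right.
by rewrite -(@staircase_right n m I I.2) // staircase_le.
Qed.

(** The two children are disjoint, so at any point at least one of the two
    averaged functions is constant in [n]; averaging therefore halves the
    distance between successive approximations. *)
Lemma staircase_cauchy n m I x : I.1 < I.2 ->
  `|staircase gap n.+1 m I x - staircase gap n m I x| <= 2 ^- n.
Proof.
elim: n m I => [|n IH] m I I12.
  have := (staircase_ge0 0 m x I12, staircase_ge0 1 m x I12).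
  have := (staircase_le1 0 m x I12, staircase_le1 1 m x I12).
  by move=> [? ?] [? ?]; rewrite expr0 invr1 ler_norml; apply/andP; split; lra.
have [_ c0 r0 _] := gapP m (half_lt false I12).
have [l1 c1 _ _] := gapP m (half_lt true I12).
rewrite !(staircaseS gap _ m) exprS invfM -mulrBl mulrC normrM.
rewrite (@ger0_norm _ 2^-1) ?invr_ge0 // ler_pM2l ?invr_gt0 //.
have [xI|/ltW xI] := leP x ((I.1 + I.2) / 2).
  have l1' := le_trans xI l1.
  by rewrite !(@staircase_left _ _ (gap m (half true I))) // !addr0 IH.
have r0' := le_trans r0 xI.
rewrite !(@staircase_right _ _ (gap m (half false I))) //.
by rewrite opprD addrACA subrr add0r IH.
Qed.

(** A point of [F (m + d)] lies outside all intervals of depth [(m + d).+1], where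
    every approximation is 0 or 1.  Going up to depth [m] takes [d.+1] averages,
    each of which costs one factor 2 in the denominator. *)
Lemma staircase_stable d m k I x : I.1 < I.2 -> F (m + d)%N x ->
  staircase gap (d.+1 + k) m I x = staircase gap d.+1 m I x /\
  2 ^+ d.+1 * staircase gap d.+1 m I x \is a Num.int.
Proof.
elim: d m I => [|d IH] m I I12 Fx.
  have H b j : staircase gap j m.+1 (gap m (half b I)) x =
      ((gap m (half b I)).2 <= x)%R%:R.
    have [_ c _ nF] := gap_halfP m b I12.
    have [rx|xr] := leP _ x; first by rewrite staircase_right.
    rewrite staircase_left // leNgt; apply/negP => lx.
    by apply: (nF x); [rewrite !ltW|rewrite -(addn0 m)].
  split; first by rewrite add1n !(staircaseS gap _ m) !H.
  rewrite (staircaseS gap _ m) !H.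
  by rewrite expr1 mulrCA divff ?mulr1 ?rpredD ?natr_int // pnatr_eq0.
rewrite -addSnnS in Fx.
have [_ c0 _ _] := gap_halfP m false I12.
have [_ c1 _ _] := gap_halfP m true I12.
have [e0 z0] := IH _ _ c0 Fx; have [e1 z1] := IH _ _ c1 Fx.
rewrite addSn !(staircaseS gap _ m); split; first by rewrite e0 e1.
by rewrite exprSr -mulrA [2 * _]mulrC mulfVK ?pnatr_eq0 // mulrDr rpredD.
Qed.

End Staircase.

(** The bound on denominators depends on [n] only, not on [I]: this uniformity is
    what lets a single sequence of weights serve for all intervals. *)
Definition adapted_step (R : realType) (F : nat -> set R) (I : R * R)
    (g : R -> R) : Prop :=
  [/\ continuous g, {homo g : x y / x <= y}, forall x, x <= I.1 -> g x = 0,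
      forall x, I.2 <= x -> g x = 1
    & forall n x, F n x -> 2 ^+ n.+1 * g x \is a Num.int].

Lemma adapted_step_exists (R : realType) (F : nat -> set R) (I : R * R) :
    (forall n, nowhere_dense (F n)) -> I.1 < I.2 ->
  exists g, adapted_step F I g.
Proof.
move=> Fnd I12.
have /choice[gap' gapP'] : forall mJ : nat * (R * R), exists K,
    mJ.2.1 < mJ.2.2 -> avoiding_gap (F mJ.1) mJ.2 K.
  move=> [m J] /=; have [J12|nJ] := pselect (J.1 < J.2); last by exists J.
  by have [K KP] := nowhere_dense_gap (Fnd m) J12; exists K.
pose gap m J := gap' (m, J).
have gapP m J : J.1 < J.2 -> avoiding_gap (F m) J (gap m J) := gapP' (m, J).
(* The error 2 ^- n of the approximations telescopes as 2 * 2 ^- n. *)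
have cauchy n x : `|staircase gap n.+1 0 I x - staircase gap n 0 I x|
    <= 2 * 2 ^- n - 2 * 2 ^- n.+1.
  apply: le_trans (staircase_cauchy gapP n 0 x I12) _.
  by rewrite exprS invfM mulrA divff ?pnatr_eq0 // mul1r; lra.
have e0 : (fun n => 2 * 2 ^- n) @ \oo --> (0 : R).
  rewrite -[X in _ --> X](mulr0 2); apply: cvgMr.
  under eq_fun do rewrite -exprVn.
  by apply: cvg_expr; rewrite ger0_norm; lra.
have [g [gc cvg_g _]] :=
  telescoping_uniform_limit (fun n => @staircase_continuous R gap n 0 I) e0 cauchy.
have lim_eq N x v : (forall k, staircase gap (N + k) 0 I x = v) -> g x = v.
  move=> H; apply: (cvg_unique (@Rhausdorff R) (cvg_g x)) => /=.
  apply: cvg_near_cst; exists N => // n /= Nn.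
  by rewrite -(subnKC Nn) H.
exists g; split => //.
- move=> x y xy; apply: (ler_cvg_to (cvg_g x) (cvg_g y)).
  by apply: nearW => n; exact: (staircase_le gapP).
- by move=> x xI; apply: (lim_eq 0%N) => k; exact: (staircase_left gapP).
- by move=> x Ix; apply: (lim_eq 0%N) => k; exact: (staircase_right gapP).
move=> n x Fx; rewrite (lim_eq n.+1 x (staircase gap n.+1 0 I x)).
  by have [] := staircase_stable gapP (m := 0%N) (d := n) 0 I12 Fx.
by move=> k; have [] := staircase_stable gapP (m := 0%N) (d := n) k I12 Fx.
Qed.

(** * Countably many intervals, each repeated infinitely often *)

(** Using [logn 2 j] rather than [j] as the code of a pair of rationals makes
    every pair occur for infinitely many [j]; the default [(0, 1)] keeps the
    interval nondegenerate and inside [0, 1] when the code is not a valid one. *)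
Definition coded_interval (R : realType) (j : nat) : R * R :=
  if (unpickle (logn 2 j) : option (rat * rat)) is Some (p, q) then
    if (0 <= p) && (p < q) && (q <= 1 :> rat) then (ratr p, ratr q) else (0, 1)
  else (0, 1).

Lemma coded_intervalP (R : realType) j :
  let I := coded_interval R j in [/\ 0 <= I.1, I.1 < I.2 & I.2 <= 1].
Proof.
rewrite /coded_interval.
have triv : [/\ (0 : R) <= 0, (0 : R) < 1 & (1 : R) <= 1] by split.
case: unpickle => [[p q]|] //; case: ifP => //= /andP[/andP[p0 pq] q1].
by split; rewrite ?ler0q ?ltr_rat // -[leRHS](rmorph1 (@ratr R)) ler_rat.
Qed.

Lemma coded_interval_cofinal (R : realType) (x y : R) N :
    0 <= x -> x < y -> y <= 1 ->
  exists2 j, (N <= j)%N &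
    let I := coded_interval R j in x <= I.1 /\ I.2 <= y.
Proof.
move=> x0 xy y1.
have [q] := rat_in_itvoo xy; rewrite in_itv /= => /andP[xq qy].
have [p] := rat_in_itvoo xq; rewrite in_itv /= => /andP[xp pq].
(* The factor 3 ^ N makes the index large without changing its code. *)
exists (2 ^ (pickle (p, q)) * 3 ^ N)%N.
  apply: leq_trans (ltnW (ltn_expl N (isT : (1 < 3)%N))) _.
  by rewrite leq_pmull // expn_gt0.
rewrite /coded_interval lognM ?expn_gt0 // pfactorK // lognX.
rewrite (_ : logn 2 3 = 0%N) // muln0 addn0 pickleK.
have -> : (0 <= p) && (p < q) && (q <= 1 :> rat).
  rewrite -(ler0q R) -(ltr_rat R) -(ler_rat R q 1) pq rmorph1.
  by rewrite (ltW (le_lt_trans x0 xp)) (ltW (lt_le_trans qy y1)).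
by split; exact: ltW.
Qed.

(** * Lacunary weights *)

(** The exponent grows quadratically so that the ratio of consecutive weights
    tends to 0: each weight is eventually negligible against any fixed
    multiple [2 ^- N] of the preceding one. *)
Definition weight (R : realType) (j : nat) : R := 2 ^- (j ^ 2).

Lemma weight_gt0 (R : realType) j : 0 < weight R j.
Proof. by rewrite invr_gt0 exprn_gt0. Qed.

Lemma weight_ge0 (R : realType) j : 0 <= weight R j.
Proof. exact/ltW/weight_gt0. Qed.

Lemma weightS (R : realType) j :
  weight R j.+1 = weight R j / 2 ^+ (2 * j).+1.
Proof. by rewrite /weight -invfM -exprD; congr (_ ^- _); lia. Qed.

Lemma weight_double (R : realType) j : 2 * weight R j.+1 <= weight R j.
Proof.
rewrite weightS mulrCA ler_piMr ?weight_ge0 //.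
rewrite exprS invfM mulrA divff ?pnatr_eq0 // mul1r.
by rewrite invf_le1 ?exprn_ege1 ?exprn_gt0 // ler1n.
Qed.

Lemma weight_tail_cvg0 (R : realType) : (fun n => 2 * weight R n) @ \oo --> 0.
Proof.
have H n : 2 * weight R n <= 2 * 2^-1 ^+ n.
  elim: n => [|n IH]; first by rewrite /weight exp0n // expr0 expr0 invr1.
  have := weight_double R n; rewrite exprS; lra.
apply: (squeeze_cvgr (f := fun=> 0) (h := fun n => 2 * 2^-1 ^+ n)).
- by apply: nearW => n; rewrite H andbT mulr_ge0 // weight_ge0.
- exact: cvg_cst.
- rewrite -[X in _ --> X](mulr0 2); apply: cvgMr.
  by apply: cvg_expr; rewrite ger0_norm; lra.
Qed.

(** The sum of the first [k.+1] terms is an integer divided by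
    [2 ^+ (k ^ 2 + N)], and [8 * weight k.+1] is smaller than this resolution
    once [N + 2 < 2 * k]; such a sum is 0, and each coefficient is a difference
    of two of them. *)
Lemma lacunary_coefficients_vanish (R : realType) (t : nat -> R) N :
    (forall j, 2 ^+ N * t j \is a Num.int) ->
    (forall n, `|\sum_(j < n) weight R j * t j| <= 8 * weight R n) ->
  forall j, (N.+3 <= j)%N -> t j = 0.
Proof.
move=> t_int tail.
have partial0 k : (N.+2 <= k)%N -> \sum_(j < k.+1) weight R j * t j = 0.
  move=> Nk; set s := \sum_(_ < _) _.
  have s_int : 2 ^+ (k ^ 2 + N) * s \is a Num.int.
    rewrite mulr_sumr; apply: rpred_sum => j _.
    have -> : 2 ^+ (k ^ 2 + N) * (weight R j * t j) =
        2 ^+ (k ^ 2 - j ^ 2) * (2 ^+ N * t j).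
      have jk : (j ^ 2 <= k ^ 2)%N by rewrite leq_sqr -ltnS.
      rewrite -{1}(subnK jk) 2!exprD /weight.
      have : (2 : R) ^+ (j ^ 2) != 0 by rewrite expf_neq0 ?pnatr_eq0.
      move: (2 ^+ (j ^ 2)) (2 ^+ (k ^ 2 - j ^ 2)) (2 ^+ N) (t j) => u v w x u0.
      by field.
    by rewrite rpredM // rpredX // natr_int.
  apply/eqP; apply: contraT => s0.
  have := norm_intr_ge1 s_int.
  rewrite mulf_neq0 ?expf_neq0 ?pnatr_eq0 // => /(_ isT).
  rewrite normrM ger0_norm ?exprn_ge0 // leNgt => /negP; case.
  (* The bound 8 * weight k.+1, rescaled by 2 ^+ (k ^ 2 + N), is
     2 ^+ (N + 3) / 2 ^+ (2 * k + 1). *)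
  have := tail k.+1; rewrite -/s.
  rewrite -(ler_pM2l (exprn_gt0 (k ^ 2 + N) (ltr0n R 2 : 0 < 2))).
  move=> /le_lt_trans; apply.
  rewrite weightS /weight exprD.
  have -> : 2 ^+ (k ^ 2) * 2 ^+ N * (8 * (2 ^- (k ^ 2) / 2 ^+ (2 * k).+1)) =
      2 ^+ (N + 3) / 2 ^+ (2 * k).+1 :> R.
    rewrite exprD; have : (2 : R) ^+ (k ^ 2) != 0 by rewrite expf_neq0 ?pnatr_eq0.
    have : (2 : R) ^+ (2 * k).+1 != 0 by rewrite expf_neq0 ?pnatr_eq0.
    have -> : (2 : R) ^+ 3 = 8 by rewrite -natrX.
    move: (2 ^+ (2 * k).+1) (2 ^+ (k ^ 2)) (2 ^+ N) => u v w u0 v0.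
    by field; rewrite u0 v0.
  rewrite ltr_pdivrMr ?exprn_gt0 // mul1r ltr_eXn2l ?ltr1n //; lia.
move=> j Nj.
have := partial0 j (ltnW Nj); rewrite big_ord_recr /=.
case: j Nj => // j Nj; rewrite partial0 // add0r => /eqP.
by rewrite mulf_eq0 gt_eqF ?weight_gt0 //= => /eqP.
Qed.

(** * Meager sets have images free of arithmetic progressions *)

Unset Implicit Arguments.
Set Strict Implicit.

Theorem proposition2 (R : realType) (C : set R)
    (C01 : C `<=` `[0, 1]%classic) (mC : meager C) :
  exists2 phi : R -> R, unit_homeo phi & FAP (phi @` C).
Proof.
case: mC => F Fnd CF.
pose I := coded_interval R.
have IP j := coded_intervalP R j.
have /choice[g gP] : forall j, exists f, adapted_step F (I j) f.
  by move=> j; apply: adapted_step_exists => //; have [] := IP j.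
have g_0 j x : x <= 0 -> g j x = 0.
  by have [_ _ h _ _] := gP j; have [? _ _] := IP j => x0; apply/h/(le_trans x0).
have g_1 j x : 1 <= x -> g j x = 1.
  by have [_ _ _ h _] := gP j; have [_ _ h1] := IP j => x1; apply/h/(le_trans h1).
have g_le j x y : x <= y -> g j x <= g j y by have [_ h _ _ _] := gP j; exact: h.
have g_bound j x : 0 <= g j x <= 1.
  apply/andP; split.
    by have [x0|/ltW x0] := leP x 0; [rewrite g_0|rewrite -(g_0 j 0) // g_le].
  by have [x1|/ltW x1] := leP 1 x; [rewrite g_1|rewrite -(g_1 j 1) // g_le].
pose S n x := \sum_(j < n) weight R j * g j x.
have S_cont n : continuous (S n).
  elim: n => [|n IH] x.
    have -> : S 0%N = fun=> 0 by apply/funext => y; rewrite /S big_ord0.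
    exact: cvg_cst.
  rewrite (_ : S n.+1 = fun y => S n y + weight R n * g n y).
    by apply: cvgD; [exact: IH|apply: cvgMr; have [h _ _ _ _] := gP n; exact: h].
  by apply/funext => y; rewrite /S big_ord_recr.
have S_step n x : `|S n.+1 x - S n x| <= 2 * weight R n - 2 * weight R n.+1.
  rewrite /S big_ord_recr /= addrAC subrr add0r.
  have /andP[g0 g1] := g_bound n x.
  rewrite ger0_norm ?mulr_ge0 ?weight_ge0 //.
  have := weight_double R n; have := weight_gt0 R n => w0 wd.
  by apply: le_trans (ler_piMr (ltW w0) g1) _; lra.
have [psi [psi_cont psi_lim psi_tail]] :=
  telescoping_uniform_limit S_cont (@weight_tail_cvg0 R) S_step.
(* An interval lying in [x, y] contributes its whole weight to the difference. *)
have psi_lt x y : 0 <= x -> x < y -> y <= 1 -> psi x < psi y.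
  move=> x0 xy y1.
  have [j _ [xj jy]] := coded_interval_cofinal 0 x0 xy y1.
  suff : weight R j <= psi y - psi x by have := weight_gt0 R j; lra.
  apply: (cvgr_to_ge (cvgB (psi_lim y) (psi_lim x))).
  exists j.+1 => // n /= jn.
  suff : weight R j <= S n y - S n x by [].
  rewrite -sumrB (bigD1 (Ordinal jn)) //=.
  have [_ _ h0 h1 _] := gP j.
  rewrite (h0 x xj) (h1 y jy) mulr0 mulr1 subr0 lerDl sumr_ge0 // => i _.
  by rewrite -mulrBr mulr_ge0 ?weight_ge0 // subr_ge0 g_le // ltW.
have psi0 : psi 0 = 0.
  apply: (cvg_unique (@Rhausdorff R) (psi_lim 0)) => /=.
  apply: cvg_near_cst; apply: nearW => n.
  by rewrite /S big1 // => i _; rewrite g_0 ?mulr0.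
have psi1 : 0 < psi 1 by rewrite -psi0 psi_lt.
have psi_le_inj x y : 0 <= x <= 1 -> 0 <= y <= 1 -> psi x < psi y -> x < y.
  move=> /andP[x0 x1] /andP[y0 y1]; apply: contraTT; rewrite -!leNgt le_eqVlt.
  by move=> /orP[/eqP->//|yx]; rewrite ltW // psi_lt.
(* Normalizing by psi 1 preserves arithmetic progressions. *)
exists (fun x => psi x / psi 1).
  apply: increasing_unit_homeo.
  - by move=> x; apply: cvgMl; exact: psi_cont.
  - by rewrite psi0 mul0r.
  - by rewrite divff // gt_eqF.
  - by move=> x y x0 xy y1; rewrite ltr_pM2r ?invr_gt0 // psi_lt.
move=> [x [d [d0 [a Ca ax] [b Cb bx] [c Cc cx]]]].
have mid : psi a + psi c - 2 * psi b = 0.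
  apply: (mulIf (x := (psi 1)^-1)); first by rewrite invr_eq0 gt_eqF.
  by rewrite mul0r mulrBl mulrDl -mulrA ax bx cx; lra.
have psi_ab : psi a < psi b.
  by rewrite -(@ltr_pM2r _ (psi 1)^-1) ?invr_gt0 // ax bx; lra.
have psi_bc : psi b < psi c.
  by rewrite -(@ltr_pM2r _ (psi 1)^-1) ?invr_gt0 // cx bx; lra.
have in01 z : C z -> 0 <= z <= 1 by move=> /C01; rewrite /= in_itv.
have ab := psi_le_inj _ _ (in01 _ Ca) (in01 _ Cb) psi_ab.
have bc := psi_le_inj _ _ (in01 _ Cb) (in01 _ Cc) psi_bc.
move: (Ca) (Cb) (Cc); rewrite CF => -[na _ Fa] [nb _ Fb] [nc _ Fc].
pose N := (na + nb + nc).+1.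
have g_int n j z : (n < N)%N -> F n z -> 2 ^+ N * g j z \is a Num.int.
  move=> nN Fz; have [_ _ _ _ h] := gP j.
  by rewrite -(subnK nN) exprD -mulrA rpredM ?rpredX ?natr_int // h.
(* The errors 2 * weight n of psi at a, b, c have coefficients 1, 2, 1, whence the
   factor 8 in t_tail. *)
pose t j := g j a + g j c - 2 * g j b.
have t_int j : 2 ^+ N * t j \is a Num.int.
  have ha : 2 ^+ N * g j a \is a Num.int by apply: g_int Fa; rewrite /N; lia.
  have hb : 2 ^+ N * g j b \is a Num.int by apply: g_int Fb; rewrite /N; lia.
  have hc : 2 ^+ N * g j c \is a Num.int by apply: g_int Fc; rewrite /N; lia.
  by rewrite /t mulrBr mulrDr mulrCA rpredB // ?rpredD // rpredM // natr_int.
have t_tail n : `|\sum_(j < n) weight R j * t j| <= 8 * weight R n.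
  have -> : \sum_(j < n) weight R j * t j = S n a + S n c - 2 * S n b.
    rewrite /S mulr_sumr -big_split -sumrB; apply: eq_bigr => i _ /=.
    by rewrite /t; ring.
  move: (psi_tail n a) (psi_tail n b) (psi_tail n c).
  rewrite !ler_norml => /andP[? ?] /andP[? ?] /andP[? ?].
  by apply/andP; split; lra.
have /andP[a0 _] := in01 _ Ca; have /andP[_ b1] := in01 _ Cb.
have [j Nj [aj jb]] := coded_interval_cofinal N.+3 a0 ab b1.
have := lacunary_coefficients_vanish t_int t_tail Nj.
have [_ _ h0 h1 _] := gP j.
by rewrite /t (h0 a aj) (h1 b jb) (h1 c (le_trans jb (ltW bc))); lra.
Qed.
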